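(* Let $H$ be any well-formed navigation history, let $\delta,\delta'\in\mathbb{Z}$, and let $H',H''$ be navigation histories. If $H$ traverses the history by $\delta$ to $H'$, and $H'$ traverses the history by $\delta'$ to $H''$, then $H$ traverses the history by $\delta+\delta'$ to $H''$.
   Context: A directed graph $(V,\rightarrow)$ is a forest if there is no $v$ with $v\rightarrow^+ v$ (where $\rightarrow^+$ is the transitive closure) and every vertex has at most one parent (if $v\rightarrow v'$ and $v''\rightarrow v'$ then $v=v''$). A navigation history $H=(D,A,\rightarrow,\le,\sim)$ consists of: a finite set $D$ (documents); a subset $A\subseteq D$ (active documents); a forest $(D,\rightarrow)$ (child relationship); a total order $(D,\le)$ (chronological order), with strict part $<$; and an equivalence relation $\sim$ on $D$ (same-session equivalence); such that: - for every $d\in D$ there is a unique $d'\in A$ with $d\sim d'$; - whenever $d\rightarrow e$ and $e\sim e'$, also $d\rightarrow e'$; - whenever $d\rightarrow e$, also $d\le e$. Write $d\lesssim e$ when $d\sim e$ and $d<e$ (so $\lesssim$ is a strict relation). The joint session future of $H$ is $\{e \mid \exists d\in A,\ d\lesssim e\}$. The joint session past of $H$ is $\{e\mid \exists d\in A,\ e\lesssim d\}$. $H$ is well-formed if for all $a\lesssim b$ and $c\lesssim d$ in $D$, if $a\in A$ and $d\in A$ then $d\le b$. Traversing to a document: for $d\in D$, traversing the history to $d$ in $H$ yields $H'=(D,A',\rightarrow,\le,\sim)$, where $e\in A'$ if and only if ($e\in A$ and $d\not\sim e$) or $e=d$. Traversing from a document: $H$ traverses the history from $d'\in D$ with result $H'$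 when there is some $d$ with $d\lesssim d'$, such that every $e\lesssim d'$ satisfies $e\le d$ (i.e. $d$ is the immediate predecessor of $d'$ in its session), and traversing the history to $d$ in $H$ yields $H'$. (If $d'$ has no predecessor in its session, traversal from $d'$ is not possible.) Traversal by an integer (a partial operation, expressed as a relation between navigation histories): - For $n\ge 1$, $H$ traverses the history by $+n$ to $H'$ when the joint session future of $H$, listed in increasing chronological order, is $d_1<\cdots<d_n<\cdots$ (it has at least $n$ elements), and there are $H=H_0,H_1,\dots,H_n=H'$ such that for each $1\le i\le n$, traversing the history to $d_i$ in $H_{i-1}$ yields $H_i$. - For $n\ge 1$, $H$ traverses the history by $-n$ to $H'$ when the set consisting of the joint session past of $H$ together with the active documents of $H$, listed in decreasing chronological order, is $d_1>\cdots>d_n>\cdots$ (it has at least $n$ elements), and there are $H=H_0,H_1,\dots,H_n=H'$ such that for each $1\le i\le n$, $H_{i-1}$ traverses the history from $d_i$ with result $H_i$. - $H$ traverses the history by $0$ to $H'$ when $H=H'$. *)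

(* Defs.v *)
From HB Require Import structures.
From Stdlib Require Import Relation_Operators.
From mathcomp Require Import all_boot all_order all_algebra.

Set Implicit Arguments.
Unset Strict Implicit.
Unset Printing Implicit Defensive.

Definition forest (V : Type) (child : rel V) : Prop :=
  (forall v, ~ clos_trans V child v v) /\
  (forall v v' v'', child v v' -> child v'' v' -> v = v'').

(* The finite set of documents is the parameter [D]: traversal never changes
   it, so all related histories live over the same [D]. *)
Record nav_history (D : finType) := NavHistory {
  active : {set D};
  child : rel D;
  chrono : rel D;
  same_session : rel D;
  child_forest : forest child;
  chrono_refl : reflexive chrono;
  chrono_anti : antisymmetric chrono;
  chrono_trans : transitive chrono;
  chrono_total : total chrono;
  same_session_refl : reflexive same_session;
  same_session_sym : symmetric same_session;
  same_session_trans : transitive same_session;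
  active_unique : forall d, exists! d', d' \in active /\ same_session d d';
  child_session : forall d e e', child d e -> same_session e e' -> child d e';
  child_chrono : forall d e, child d e -> chrono d e
}.

Section Traversal.

Variable D : finType.
Implicit Types (H : nav_history D) (d e : D).

Definition session_lt H : rel D :=
  fun d e => [&& same_session H d e, chrono H d e & d != e].

Definition joint_future H : {set D} :=
  [set e | [exists d in active H, session_lt H d e]].

Definition joint_past H : {set D} :=
  [set e | [exists d in active H, session_lt H e d]].

Definition well_formed H : Prop :=
  forall a b c d, session_lt H a b -> session_lt H c d ->
    a \in active H -> d \in active H -> chrono H d b.

Definition traverses_to H d H' : Prop :=
  [/\ forall e, e \in active H' <->
        (e \in active H /\ ~ same_session H d e) \/ e = d,
      child H' = child H,
      chrono H' = chrono H
    & same_session H' = same_session H].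

Definition traverses_from H d' H' : Prop :=
  exists d, [/\ session_lt H d d',
                forall e, session_lt H e d' -> chrono H e d
              & traverses_to H d H'].

(* [chain step H [:: d_1; ...; d_n] H'] says that there are
   H = H_0, ..., H_n = H' with [step H_(i-1) d_i H_i] for 1 <= i <= n. *)
Fixpoint chain (step : nav_history D -> D -> nav_history D -> Prop)
    H (ds : seq D) H' : Prop :=
  if ds is d :: ds' then exists H1, step H d H1 /\ chain step H1 ds' H'
  else H = H'.

Definition increasing_listing H (S : {set D}) : seq D :=
  sort (chrono H) (enum S).

Definition decreasing_listing H (S : {set D}) : seq D :=
  sort (fun d e => chrono H e d) (enum S).

Definition traverses_forward (n : nat) H H' : Prop :=
  let ds := increasing_listing H (joint_future H) in
  n <= size ds /\ chain traverses_to H (take n ds) H'.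

Definition traverses_back (n : nat) H H' : Prop :=
  let ds := decreasing_listing H (joint_past H :|: active H) in
  n <= size ds /\ chain traverses_from H (take n ds) H'.

(* [Negz n] is the integer -(n+1). *)
Definition traverses_by H (delta : int) H' : Prop :=
  match delta with
  | Posz 0 => H = H'
  | Posz n.+1 => traverses_forward n.+1 H H'
  | Negz n => traverses_back n.+1 H H'
  end.

End Traversal.

(* Main.v *)
(* Call a document noninitial if it has a predecessor in its session.  A
   well-formed history is determined, up to its fixed frame, by a cut: the
   noninitial documents not later than the active document of their session
   are exactly the first k in the chronological order.  Traversing by delta
   moves the cut to k + delta, with one extra proviso when delta < 0: the
   initial documents, which also occur in the list used for backward
   traversal, must all be older than the noninitial ones crossed by the cut.
   Both conditions compose. *)
From Stdlib Require Import ProofIrrelevance.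
Require Import Defs.
From mathcomp Require Import all_boot all_order all_algebra zify.

Set Implicit Arguments.
Unset Strict Implicit.
Unset Printing Implicit Defensive.

Section Histories.

Variable D : finType.
Implicit Types (H : nav_history D) (d e a : D).

(** * Histories with a common frame *)

Definition same_frame H H' : Prop :=
  [/\ child H' = child H, chrono H' = chrono H
    & same_session H' = same_session H].

Lemma same_frame_sym H H' : same_frame H H' -> same_frame H' H.
Proof. by case. Qed.

Lemma same_frame_trans H1 H2 H3 :
  same_frame H1 H2 -> same_frame H2 H3 -> same_frame H1 H3.
Proof. by move=> [ec el es] [ec' el' es']; split; rewrite (ec', el', es'). Qed.

(* Traversal by 0 is equality of records, proof fields included. *)
Lemma same_frame_eq H H' :
  same_frame H H' -> active H = active H' -> H = H'.
Proof.
case: H => A c le s p1 p2 p3 p4 p5 p6 p7 p8 p9 p10 p11.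
case: H' => A' c' le' s' q1 q2 q3 q4 q5 q6 q7 q8 q9 q10 q11.
rewrite /same_frame /= => -[ec el es] eA; subst.
by rewrite (proof_irrelevance _ p1 q1) (proof_irrelevance _ p2 q2)
  (proof_irrelevance _ p3 q3) (proof_irrelevance _ p4 q4)
  (proof_irrelevance _ p5 q5) (proof_irrelevance _ p6 q6)
  (proof_irrelevance _ p7 q7) (proof_irrelevance _ p8 q8)
  (proof_irrelevance _ p9 q9) (proof_irrelevance _ p10 q10)
  (proof_irrelevance _ p11 q11).
Qed.

Lemma active_repr H d :
  exists a, [/\ a \in active H, same_session H d a
              & forall a', a' \in active H -> same_session H d a' -> a' = a].
Proof.
have [a [[aA da] uniq_a]] := active_unique H d.
by exists a; split=> // a' aA' da'; rewrite (uniq_a a').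
Qed.

Lemma active_inj H a a' :
  a \in active H -> a' \in active H -> same_session H a a' -> a = a'.
Proof.
move=> aA aA' aa'; have [b [_ _ ub]] := active_repr H a.
by rewrite (ub a aA (same_session_refl H a)) (ub a' aA' aa').
Qed.

Lemma not_chrono_lt H d e :
  same_session H d e -> ~~ chrono H e d -> session_lt H d e.
Proof.
move=> de ned; have := chrono_total H d e.
rewrite (negbTE ned) orbF => le_de; rewrite /session_lt de le_de /=.
by apply: contraNneq ned => ->; rewrite chrono_refl.
Qed.

(** * Noninitial documents, their ranking, and cuts *)

Definition noninitial H : {set D} := [set e | [exists d, session_lt H d e]].

Definition ranking H : seq D := sort (chrono H) (enum (noninitial H)).

Definition reached H : {set D} := joint_past H :|: active H.

(** Initial documents need no clause, being always reached. The bound makes [k] the exact number of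
    reached noninitial documents. *)
Definition at_cut H k : Prop :=
  k <= size (ranking H) /\
  forall d, d \in noninitial H -> (d \in reached H) = (index d (ranking H) < k).

Lemma noninitialP H d e : session_lt H d e -> e \in noninitial H.
Proof. by move=> de; rewrite inE; apply/existsP; exists d. Qed.

Lemma noninitial_frame H H' : same_frame H H' -> noninitial H' = noninitial H.
Proof. by case=> _ el es; rewrite /noninitial /session_lt el es. Qed.

Lemma ranking_frame H H' : same_frame H H' -> ranking H' = ranking H.
Proof.
by move=> fH; rewrite /ranking (noninitial_frame fH); case: fH => _ -> _.
Qed.

Lemma mem_ranking H d : (d \in ranking H) = (d \in noninitial H).
Proof. by rewrite mem_sort mem_enum. Qed.

Lemma ranking_uniq H : uniq (ranking H).
Proof. by rewrite sort_uniq enum_uniq. Qed.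

Lemma ranking_sorted H : sorted (chrono H) (ranking H).
Proof. exact/sort_sorted/chrono_total. Qed.

Lemma index_ranking H d e : d \in noninitial H -> e \in noninitial H ->
  (index d (ranking H) <= index e (ranking H)) = chrono H d e.
Proof.
rewrite -!mem_ranking => dL eL.
have mono := sorted_leq_index (@chrono_trans _ H) (@chrono_refl _ H)
  (ranking_sorted H).
apply/idP/idP => [|le_de]; first exact: mono.
case: leqP => // lt_ed; have le_ed := mono _ _ eL dL (ltnW lt_ed).
have ede : d = e by apply: (@chrono_anti _ H); rewrite le_de.
by rewrite ede ltnn in lt_ed.
Qed.

Lemma index_ranking_inj H d e : d \in noninitial H -> e \in noninitial H ->
  index d (ranking H) = index e (ranking H) -> d = e.
Proof. by rewrite -!mem_ranking; apply: (index_inj d). Qed.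

Lemma ranking_at H k : k < size (ranking H) ->
  exists d, [/\ d \in noninitial H, index d (ranking H) = k,
    drop k (ranking H) = d :: drop k.+1 (ranking H)
    & take k.+1 (ranking H) = rcons (take k (ranking H)) d].
Proof.
move=> ltk; case e: (ranking H) (ltk) => [//|x0 s] _; rewrite -e.
exists (nth x0 (ranking H) k); rewrite -mem_ranking mem_nth //.
by rewrite index_uniq ?ranking_uniq // -drop_nth // -take_nth.
Qed.

(** A session has only one active document, so the existential in [joint_past] collapses to a
    comparison with [a]. *)
Lemma reachedE H d a : a \in active H -> same_session H d a ->
  (d \in reached H) = chrono H d a.
Proof.
move=> aA da; rewrite in_setU inE; apply/orP/idP => [[]|le_da].
- case/existsP=> b /and3P[bA db /andP[le_db _]].
  rewrite (@active_inj H a b) //.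
  by apply: same_session_trans db; rewrite same_session_sym.
- by move=> dA; rewrite (active_inj dA aA da) chrono_refl.
have [<-|da'] := eqVneq a d; [by right | left].
by apply/existsP; exists a; rewrite aA /session_lt da le_da eq_sym.
Qed.

(** Otherwise the active document of the session would be a predecessor of [d]. *)
Lemma initial_reached H d : d \notin noninitial H -> d \in reached H.
Proof.
move=> dI; have [a [aA da _]] := active_repr H d.
rewrite (reachedE aA da); apply: contraR dI => /not_chrono_lt nda.
by apply/(@noninitialP H a)/nda; rewrite same_session_sym.
Qed.

Lemma joint_futureE H : joint_future H = noninitial H :\: reached H.
Proof.
apply/setP=> e; rewrite in_setD inE.
have [a [aA ea _]] := active_repr H e; rewrite (reachedE aA ea).
apply/existsP/andP => [[d /andP[dA de]]|[nea _]]; last first.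
  by exists a; rewrite aA not_chrono_lt // same_session_sym.
split; last exact: noninitialP de.
case/and3P: de => sde le_de nde; apply: contraNN nde => le_ea.
have ed : same_session H e d by rewrite same_session_sym.
have le_ed : chrono H e d by rewrite -(reachedE dA ed) (reachedE aA ea).
by apply/eqP/(@chrono_anti _ H); rewrite le_de.
Qed.

(** * The two listings, read off from the cut *)

Lemma mem_drop_uniq (s : seq D) i d : uniq s ->
  (d \in drop i s) = (d \in s) && (d \notin take i s).
Proof.
rewrite -{1 3}(cat_take_drop i s) cat_uniq mem_cat => /and3P[_ /hasPn disj _].
by case: (boolP (d \in drop i s)) => [/disj ->|_]; rewrite ?orbT ?orbF ?andbN.
Qed.

Lemma future_listing H k : at_cut H k ->
  increasing_listing H (joint_future H) = drop k (ranking H).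
Proof.
case=> lek cutH; apply: (sorted_eq (@chrono_trans _ H) (@chrono_anti _ H)).
- exact/sort_sorted/chrono_total.
- exact/drop_sorted/ranking_sorted.
apply: uniq_perm; rewrite ?sort_uniq ?enum_uniq ?drop_uniq ?ranking_uniq //.
move=> d; rewrite mem_sort mem_enum joint_futureE in_setD.
rewrite mem_drop_uniq ?ranking_uniq // mem_ranking andbC.
by apply: andb_id2l => dN; rewrite cutH // in_take ?mem_ranking.
Qed.

Lemma decreasing_listing_sorted H S :
  sorted (fun d e => chrono H e d) (decreasing_listing H S).
Proof. by apply/sort_sorted => d e; apply: chrono_total. Qed.

Lemma decreasing_eq H (s t : seq D) :
  sorted (fun d e => chrono H e d) s -> sorted (fun d e => chrono H e d) t ->
  uniq s -> uniq t -> s =i t -> s = t.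
Proof.
move=> ss st us ut est.
apply: (sorted_eq (leT := fun d e => chrono H e d)) => //.
- by move=> y x z le_yx le_zy; apply: chrono_trans le_yx.
- by move=> x y le_xy; apply: (@chrono_anti _ H); rewrite andbC.
exact: uniq_perm.
Qed.

(** The filter is there because the backward listing also contains all initial documents, possibly
    interleaved with the others; the forward listing contains none. *)
Lemma past_listing H k : at_cut H k ->
  [seq d <- decreasing_listing H (reached H) | d \in noninitial H]
  = rev (take k (ranking H)).
Proof.
case=> lek cutH; apply: (@decreasing_eq H).
- apply: sorted_filter (decreasing_listing_sorted _ _).
  by move=> y x z le_yx le_zy; apply: chrono_trans le_yx.
- by rewrite rev_sorted; apply/take_sorted/ranking_sorted.
- by rewrite filter_uniq // sort_uniq enum_uniq.
- by rewrite rev_uniq take_uniq // ranking_uniq.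
move=> d; rewrite mem_filter mem_rev mem_sort mem_enum.
case: (boolP (d \in noninitial H)) => dN /=.
  by rewrite cutH // in_take ?mem_ranking.
by apply/esym; apply: contraNF dN => /mem_take; rewrite mem_ranking.
Qed.

(** * Effect of a single step *)

Lemma traverses_to_frame H d H' : traverses_to H d H' -> same_frame H H'.
Proof. by case. Qed.

(** Supplies the intermediate histories when a chain is rebuilt from its end points. Only
    [active_unique] has to be proved afresh: [d] serves its own session, and every other session
    keeps its active document. *)
Lemma traverses_to_exists H d : exists H', traverses_to H d H'.
Proof.
pose A := [set e | (e \in active H) && ~~ same_session H d e || (e == d)].
have uA : forall e, exists! a, a \in A /\ same_session H e a.
  move=> e; have [a [aA ea ua]] := active_repr H e.
  have [de|nde] := boolP (same_session H d e).
    exists d; split=> [|b [+ eb]]; first by rewrite inE eqxx orbT same_session_sym.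
    rewrite inE => /orP[/andP[_ /negP[]]|/eqP//].
    exact: same_session_trans de eb.
  have nab b : same_session H e b -> ~~ same_session H d b.
    move=> eb; apply: contraNN nde => db.
    by apply: same_session_trans db _; rewrite same_session_sym.
  exists a; split=> [|b [+ eb]]; first by rewrite inE aA nab.
  rewrite inE => /orP[/andP[bA _]|/eqP bd]; first by rewrite (ua b).
  by move: (nab _ eb); rewrite bd same_session_refl.
exists (NavHistory (child_forest H) (@chrono_refl _ H) (@chrono_anti _ H)
  (@chrono_trans _ H) (@chrono_total _ H) (@same_session_refl _ H)
  (@same_session_sym _ H) (@same_session_trans _ H) uA
  (@child_session _ H) (@child_chrono _ H)).
split=> // e /=; rewrite inE; split.
  by case/orP=> [/andP[-> /negP]|/eqP->]; [left | right].
by case=> [[-> /negP->]|->]; rewrite ?eqxx ?orbT.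
Qed.

Lemma traverses_to_reached H d H' e : traverses_to H d H' ->
  (e \in reached H') =
  if same_session H d e then chrono H e d else e \in reached H.
Proof.
case=> actH' _ el es; case: ifPn => [de|nde].
  by rewrite (@reachedE H' e d) ?el ?es 1?same_session_sym //; apply/actH'; right.
have [a [aA ea _]] := active_repr H e.
rewrite (@reachedE H' e a) ?(reachedE aA ea) ?el ?es //.
apply/actH'; left; split=> // da; case/negP: nde.
by apply: same_session_trans da _; rewrite same_session_sym.
Qed.

(** The cut fixes the reached documents, and the active document of a session is its latest reached
    one. *)
Lemma at_cut_unique H H' k :
  same_frame H H' -> at_cut H k -> at_cut H' k -> H = H'.
Proof.
move=> fH [lek cutH] [_ cutH']; apply: same_frame_eq => //.
have eR : reached H = reached H'.
  apply/setP=> d; have [dN|dI] := boolP (d \in noninitial H).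
    by rewrite cutH // cutH' ?(ranking_frame fH) ?(noninitial_frame fH).
  by rewrite !initial_reached ?(noninitial_frame fH).
have [_ el es] := fH.
apply/setP=> a.
have [b [bA ab _]] := active_repr H a; have [b' [bA' ab' _]] := active_repr H' a.
(* Each of [b] and [b'] is reached in its own history, hence in the other one, so each is at most
   the other. *)
have eb : b = b'.
  have bb' : same_session H b b'.
    by apply: same_session_trans (_ : same_session H b a) _; rewrite -?es // es same_session_sym.
  apply: (@chrono_anti _ H); apply/andP; split.
    rewrite -el -(@reachedE H' b b') ?es // -eR (@reachedE H b b) //.
      exact: chrono_refl.
    exact: same_session_refl.
  rewrite -(@reachedE H b' b) // 1?same_session_sym // eR (@reachedE H' b' b') //.
    exact: chrono_refl.
  exact: same_session_refl.
apply/idP/idP => aA.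
  by rewrite (active_inj aA bA ab) eb.
by rewrite (active_inj aA bA' ab') -eb.
Qed.

Lemma at_cut_step H d H' k : d \in noninitial H -> index d (ranking H) = k ->
  at_cut H k -> traverses_to H d H' -> at_cut H' k.+1.
Proof.
move=> dN <- [_ cutH] stepH; have fH := traverses_to_frame stepH.
split; rewrite (ranking_frame fH) ?(noninitial_frame fH).
  by rewrite index_mem mem_ranking.
move=> e eN; rewrite (traverses_to_reached e stepH) ltnS.
case: ifPn => [_|nde]; first by rewrite index_ranking.
(* Outside the session of [d] nothing changes, and no document there has the rank of [d]; so [<] and
   [<=] agree on its rank. *)
rewrite cutH // ltn_neqAle andb_idl // => _.
by apply: contraNneq nde => /(index_ranking_inj eN dN) ->; apply: same_session_refl.
Qed.

Lemma at_cut_back H d H' k : d \in noninitial H -> index d (ranking H) = k ->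
  at_cut H k.+1 -> traverses_from H d H' -> same_frame H H' /\ at_cut H' k.
Proof.
move=> dN <- [lek cutH] [p [/and3P[pd le_pd neq_pd] maxp stepH]].
have fH := traverses_to_frame stepH; split=> //.
split; rewrite (ranking_frame fH) ?(noninitial_frame fH).
  exact: ltnW.
move=> e eN; rewrite (traverses_to_reached e stepH).
case: ifPn => [pe|npe]; last first.
  rewrite cutH // ltnS [RHS]ltn_neqAle andb_idl // => _.
  by apply: contraNneq npe => /(index_ranking_inj eN dN) ->.
rewrite ltnNge index_ranking //.
have ed : same_session H e d.
  by apply: same_session_trans pd; rewrite same_session_sym.
(* By maximality of [p], the documents of the session not later than [p] are exactly those strictly
   before [d]. *)
apply/idP/idP => [le_ep|nde]; last by apply/maxp/not_chrono_lt.
apply: contraNN neq_pd => le_de; apply/eqP/(@chrono_anti _ H).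
by rewrite le_pd (chrono_trans le_de).
Qed.

(** The immediate predecessor is the last entry of the sorted list of predecessors. *)
Lemma traverses_from_exists H d : d \in noninitial H ->
  exists H', traverses_from H d H'.
Proof.
rewrite inE => /existsP[p0 p0d].
pose s := sort (chrono H) (enum [set p | session_lt H p d]).
have sp p : (p \in s) = session_lt H p d by rewrite mem_sort mem_enum inE.
have ss : sorted (chrono H) s by apply/sort_sorted/chrono_total.
have : p0 \in s by rewrite sp.
case/lastP: s sp ss => // s p sp ss _.
have [H' stepH] := traverses_to_exists H p.
exists H', p; split=> //; first by rewrite -sp mem_rcons mem_head.
move=> e; rewrite -sp mem_rcons inE => /orP[/eqP->|es]; first exact: chrono_refl.
move: ss; rewrite (sorted_pairwise (@chrono_trans _ H)) pairwise_rcons.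
by case/andP=> /allP/(_ e es).
Qed.

(** * Chains of steps as shifts of the cut *)

(** Each step crosses the document of rank [k] and raises the cut by one. The converse holds because
    steps always exist and frame and cut determine the final history. *)
Lemma chain_forward H k n H' : at_cut H k -> k + n <= size (ranking H) ->
  chain (@traverses_to D) H (take n (drop k (ranking H))) H' <->
  same_frame H H' /\ at_cut H' (k + n).
Proof.
elim: n H k => [|n IHn] H k cutH lek.
  rewrite take0 addn0 /=; split=> [<-|[]]; first by [].
  by move=> fH; apply: at_cut_unique fH cutH.
have [|d [dN dk -> _]] := @ranking_at H k; first lia.
have next H1 : traverses_to H d H1 ->
    chain (@traverses_to D) H1 (take n (drop k.+1 (ranking H))) H' <->
    same_frame H1 H' /\ at_cut H' (k + n.+1).
  move=> stepH; have fH := traverses_to_frame stepH.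
  rewrite -(ranking_frame fH) addnS -addSn; apply: IHn.
    exact: at_cut_step dN dk cutH stepH.
  by rewrite (ranking_frame fH) addSnnS.
rewrite /=; split=> [[H1 [stepH]]|[fH' cutH']].
  case/(next _ stepH)=> fH1 cutH'; split=> //.
  exact: same_frame_trans (traverses_to_frame stepH) fH1.
have [H1 stepH] := traverses_to_exists H d; exists H1; split=> //.
apply/(next _ stepH); split=> //.
exact: same_frame_trans (same_frame_sym (traverses_to_frame stepH)) fH'.
Qed.

Lemma chain_back H k n H' : at_cut H k -> n <= k ->
  chain (@traverses_from D) H (take n (rev (take k (ranking H)))) H' <->
  same_frame H H' /\ at_cut H' (k - n).
Proof.
elim: n H k => [|n IHn] H k cutH lek.
  rewrite take0 subn0 /=; split=> [<-|[]]; first by [].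
  by move=> fH; apply: at_cut_unique fH cutH.
case: k cutH lek => // k cutH lek.
have [|d [dN dk _ ->]] := @ranking_at H k; first by case: cutH.
have next H1 : traverses_from H d H1 -> same_frame H H1 /\
    (chain (@traverses_from D) H1 (take n (rev (take k (ranking H)))) H' <->
    same_frame H1 H' /\ at_cut H' (k.+1 - n.+1)).
  case/(at_cut_back dN dk cutH) => fH cutH1; split=> //.
  by rewrite -(ranking_frame fH) subSS; apply: IHn.
rewrite rev_rcons /=; split=> [[H1 [stepH]]|[fH' cutH']].
  have [fH iffH] := next _ stepH.
  case/iffH=> fH1 cutH'; split=> //.
  exact: same_frame_trans fH fH1.
have [H1 stepH] := traverses_from_exists dN; exists H1; split=> //.
have [fH iffH] := next _ stepH; apply/iffH; split=> //.
exact: same_frame_trans (same_frame_sym fH) fH'.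
Qed.

(** Source of the proviso on backward traversal: a chain cannot pass an initial document, from which
    no step is possible. *)
Lemma chain_back_noninitial H ds H' : chain (@traverses_from D) H ds H' ->
  {subset ds <= noninitial H}.
Proof.
elim: ds H => [//|d ds IHds] H [H1 [[p [pd _ stepH]]]] /IHds.
rewrite (noninitial_frame (traverses_to_frame stepH)) => sub e.
by rewrite inE => /orP[/eqP->|/sub//]; apply: noninitialP pd.
Qed.

(** * Initial documents in the backward listing *)

(** The proviso for moving back to cut [k]. Ranks have no upper bound here: what is older than the
    document of rank [k] is older than all later ones. Hence the starting cut is not mentioned,
    which lets provisos compose. *)
Definition initials_below H k : Prop :=
  forall i d, i \notin noninitial H -> d \in noninitial H ->
    k <= index d (ranking H) -> chrono H i d.

Lemma initials_below_frame H H' k :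
  same_frame H H' -> initials_below H' k <-> initials_below H k.
Proof.
move=> fH; rewrite /initials_below (ranking_frame fH) (noninitial_frame fH).
by case: fH => _ -> _.
Qed.

Lemma initials_below_leq H k k' :
  k <= k' -> initials_below H k -> initials_below H k'.
Proof. by move=> lek bel i d iI dN lek'; apply: bel => //; apply: leq_trans lek'. Qed.

Lemma take_past H k n : n <= k -> k <= size (ranking H) ->
  take n (rev (take k (ranking H))) = rev (drop (k - n) (take k (ranking H))).
Proof. by move=> lenk lek; rewrite take_rev size_takel. Qed.

Lemma mem_take_past H k n d : n <= k -> k <= size (ranking H) ->
  (d \in take n (rev (take k (ranking H)))) =
  (d \in noninitial H) && (k - n <= index d (ranking H) < k).
Proof.
move=> lenk lek; rewrite take_past // mem_rev.
rewrite mem_drop_uniq ?take_uniq ?ranking_uniq // take_takel ?leq_subr //.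
have [dN|dI] := boolP (d \in noninitial H).
  by rewrite !in_take ?mem_ranking // -leqNgt andbC.
by apply: contraNF dI => /andP[/mem_take]; rewrite mem_ranking.
Qed.

Lemma listing_initials_below H k n : at_cut H k -> 0 < n ->
  let ds := decreasing_listing H (reached H) in
  n <= size ds -> {subset take n ds <= noninitial H} ->
  [/\ n <= k, take n ds = take n (rev (take k (ranking H)))
    & initials_below H (k - n)].
Proof.
move=> cutH n_gt0 ds len sub.
(* Filtering leaves the first [n] entries intact, so they are a prefix of the reversed ranking below
   the cut. *)
have eds : take n ds ++ [seq d <- drop n ds | d \in noninitial H]
    = rev (take k (ranking H)).
  have <- : [seq d <- take n ds | d \in noninitial H] = take n ds.
    exact/all_filterP/allP.
  by rewrite -filter_cat cat_take_drop (past_listing cutH).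
have szt : size (take n ds) = n by rewrite size_takel.
have lenk : n <= k.
  have := congr1 size eds; rewrite size_cat szt size_rev size_takel.
    by move=> <-; apply: leq_addr.
  by case: cutH.
have et : take n ds = take n (rev (take k (ranking H))).
  by rewrite -eds take_size_cat.
split=> // i d iI dN led.
(* [x] is the oldest of the first [n] entries; it exists since [n] is positive. Initial documents
   come after it in the listing, so they are older. *)
have [|x [xN xk _ _]] := @ranking_at H (k - n); first by case: cutH => lek _; lia.
apply: (@chrono_trans _ H x); last by rewrite -index_ranking // xk.
have xt : x \in take n ds.
  by rewrite et mem_take_past ?xN ?xk //; case: cutH => // lek _; lia.
have iD : i \in drop n ds.
  have : i \in ds by rewrite mem_sort mem_enum initial_reached.
  rewrite -{1}(cat_take_drop n ds) mem_cat => /orP[/sub|//].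
  by rewrite (negbTE iI).
have := decreasing_listing_sorted H (reached H); rewrite -/ds -(cat_take_drop n ds).
rewrite sorted_pairwise; last by move=> y u z le_yu le_zy; apply: chrono_trans le_yu.
by rewrite pairwise_cat => /and3P[/allrelP/(_ _ _ xt iD)].
Qed.

(** Under the proviso, the top [n] noninitial documents followed by the sorted rest form a
    decreasing list, which must be the listing. *)
Lemma initials_below_listing H k n : at_cut H k -> n <= k ->
  initials_below H (k - n) ->
  let ds := decreasing_listing H (reached H) in
  n <= size ds /\ take n ds = take n (rev (take k (ranking H))).
Proof.
move=> [lek cutH] lenk bel ds.
set top := take n (rev _).
pose rest := decreasing_listing H (reached H :\: [set d in top]).
have szt : size top = n by rewrite size_takel // size_rev size_takel.
have memt d : (d \in top) =
    (d \in noninitial H) && (k - n <= index d (ranking H) < k).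
  exact: mem_take_past.
suff -> : ds = top ++ rest by rewrite size_cat take_size_cat // szt leq_addr.
have ge_trans : transitive (fun d e => chrono H e d).
  by move=> y x z le_yx le_zy; apply: chrono_trans le_yx.
have memr d : (d \in rest) = (d \notin top) && (d \in reached H).
  by rewrite mem_sort mem_enum in_setD inE.
apply: (@decreasing_eq H).
- exact: decreasing_listing_sorted.
- have sortt : sorted (fun d e => chrono H e d) top.
    by apply: take_sorted; rewrite rev_sorted; apply/take_sorted/ranking_sorted.
  have sortr : sorted (fun d e => chrono H e d) rest := decreasing_listing_sorted _ _.
  move: sortt sortr; rewrite !(sorted_pairwise ge_trans) pairwise_cat => -> ->.
  rewrite !andbT; apply/allrelP=> d e; rewrite memr !memt => /and3P[dN led _].
  (* A noninitial reached [e] outside [top] has rank below [k - n], hence precedes [d]; for an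
     initial [e] the proviso applies. *)
  case/andP=> + eR; have [eN|eI _] := boolP (e \in noninitial H).
    rewrite -(cutH e eN) eR andbT -ltnNge => lte.
    by rewrite -index_ranking // ltnW // (leq_trans lte).
  exact: bel.
- by rewrite sort_uniq enum_uniq.
- rewrite cat_uniq take_uniq ?rev_uniq ?take_uniq ?ranking_uniq //=.
  rewrite sort_uniq enum_uniq andbT; apply/hasPn=> d.
  by rewrite memr => /andP[].
move=> d; rewrite mem_cat memr mem_sort mem_enum.
have [|_] := boolP (d \in top); last by [].
by rewrite memt => /and3P[dN _ ltd]; rewrite cutH.
Qed.

(** * Well-formedness and traversal by an integer *)

Lemma well_formed_at_cut H : well_formed H -> exists k, at_cut H k.
Proof.
(* The rank of the first unreached noninitial document, or the length of the ranking if there is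
   none. *)
move=> wfH; pose k := find (fun d => d \notin reached H) (ranking H).
exists k; split=> [|d dN]; first exact: find_size.
case: ltnP => [ltk|lek].
  have := before_find d ltk; rewrite nth_index ?mem_ranking //.
  by move/negbFE.
have ltk : k < size (ranking H).
  by apply: leq_ltn_trans lek _; rewrite index_mem mem_ranking.
have [x [xN xk _ _]] := ranking_at ltk.
have nxR : x \notin reached H.
  have := ltk; rewrite -has_find => /(nth_find x).
  by rewrite -/k -{1}xk nth_index ?mem_ranking.
have xF : x \in joint_future H by rewrite joint_futureE in_setD nxR.
move: xF; rewrite inE => /existsP[a /andP[aA ax]].
have le_xd : chrono H x d by rewrite -index_ranking // xk.
have [c [cA dc _]] := active_repr H d; rewrite (reachedE cA dc).
apply/negP => le_dc.
(* Well-formedness can be applied to [c] only if it has a predecessor: [d] itself, or one of [d]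
   when [c] is [d]. It yields [c <= x], while [x <= d <= c]; so the unreached [x] would be
   active. *)
have [p pc] : exists p, session_lt H p c.
  have [<-|ndc] := eqVneq d c; last by exists d; apply/and3P.
  by move: dN; rewrite inE => /existsP.
have le_cx := wfH _ _ _ _ ax pc aA cA.
have exc : x = c.
  by apply: (@chrono_anti _ H); rewrite le_cx (chrono_trans le_xd).
by case/negP: nxR; rewrite exc in_setU cA orbT.
Qed.

(** Taking [k'] natural encodes that the shifted cut is not negative; its upper bound is part of
    [at_cut]. *)
Lemma traverses_byP H k delta H' : at_cut H k ->
  traverses_by H delta H' <->
  exists k', [/\ Posz k' = (Posz k + delta)%R, same_frame H H', at_cut H' k'
               & k' < k -> initials_below H k'].
Proof.
move=> cutH; case: delta => [[|n]|n].
- split=> [<-|[k' [ek fH cutH' _]]].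
    by exists k; rewrite GRing.addr0 ltnn.
  by apply: at_cut_unique fH cutH _; have -> : k = k' by lia.
- rewrite /= /traverses_forward (future_listing cutH) size_drop.
  split=> [[len ch]|[k' [ek fH cutH' _]]].
    have lek : k + n.+1 <= size (ranking H) by lia.
    have [fH cutH'] := (chain_forward H' cutH lek).1 ch.
    by exists (k + n.+1); split=> //; lia.
  have ek' : k' = k + n.+1 by lia.
  have lek : k + n.+1 <= size (ranking H).
    by rewrite -ek' -(ranking_frame fH); case: cutH'.
  split; first lia.
  by apply/chain_forward => //; rewrite -ek'.
rewrite /= /traverses_back -/(reached H).
split=> [[len ch]|[k' [ek fH cutH' bel]]].
  have [//|lenk ets bel] := listing_initials_below cutH _ len (chain_back_noninitial ch).
  move: ch; rewrite ets => /(chain_back H' cutH lenk)[fH cutH'].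
  by exists (k - n.+1); split=> //; lia.
have ek' : k' = k - n.+1 by lia.
have lenk : n.+1 <= k by lia.
have [|len ->] := initials_below_listing cutH lenk; first by rewrite -ek'; apply: bel; lia.
by split=> //; apply/chain_back => //; rewrite -ek'.
Qed.

End Histories.

Theorem theorem1 (D : finType) (H H' H'' : nav_history D) (delta delta' : int) :
  well_formed H ->
  traverses_by H delta H' ->
  traverses_by H' delta' H'' ->
  traverses_by H (delta + delta')%R H''.
Proof.
move=> /well_formed_at_cut[k cutH].
case/(traverses_byP _ _ cutH)=> k1 [ek1 fH1 cutH1 bel1].
case/(traverses_byP _ _ cutH1)=> k2 [ek2 fH2 cutH2 bel2].
apply/(traverses_byP _ _ cutH); exists k2; split=> //; first lia.
  exact: same_frame_trans fH1 fH2.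
(* If the second move goes back, it provides the proviso at [k2]. Otherwise [k1 <= k2 < k], so the
   first move went back, and its proviso at [k1] implies the one at [k2]. *)
move=> lt2; case: (ltnP k2 k1) => [/bel2/(initials_below_frame _ fH1)//|le12].
exact: initials_below_leq le12 (bel1 (leq_ltn_trans le12 lt2)).
Qed.
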